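(* Consider a single-step partially observable off-switch game (PO-OSG) with task utilities bounded by $B$, and let $U_1,\dots,U_5$ be the utilities defined in the context. Let the assistant maximize $\mathbb E_{\pi_A,\pi_H}[U_A]$ with $U_A=\sum_{i=1}^5\alpha_iU_i$, $\alpha_1>\alpha_2>\alpha_3>\alpha_4>\alpha_5>0$, under the weight gaps $$\alpha_1>\alpha_3+\tfrac12\alpha_4+B\alpha_5,\qquad \alpha_3>\tfrac12\alpha_4+B\alpha_5,\qquad \alpha_4>\frac{2B}{|c_{\min}|}\alpha_5.$$ Assume the human policy $\pi_H$ satisfies Vigilance: for every triple $(O_H,a_A,m_A)$ in the support of the game, $\pi_H(a_H=\mathsf{OFF}\mid O_H,a_A,m_A)=1$ whenever $$\mathbb E_{\pi_A,\pi_H}[u_a(S)\mid O_H,a_A,m_A]<\mathbb E_{\pi_A,\pi_H}[u_o(S)\mid O_H,a_A,m_A].$$ Assume further that the game satisfies Caution: $\mathbb E_{S\sim P_0}[u_o(S)]\ge0$. Then every optimal assistant policy $\pi_A^\star$ satisfies $$\mathbb E_{\pi_A^\star,\pi_H}[U_5]\ge0.$$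
   Context: **Single-step PO-OSG.** One round is played. Its history is $h=\langle S,O_A,O_H,m_A,a_A,a_H\rangle$, where: $S\in\mathcal S$ is the true state, drawn from $P_0$ and hidden from both players; $O_A\in\mathcal O_A$, $O_H\in\mathcal O_H$ are the observations of assistant and human (drawn from $P(O_A,O_H\mid S)$); $m_A$ is a (possibly empty) message uttered by the assistant; $a_A\in A=\{a,w(a),\mathsf{OFF}\}$ is the assistant's move (respectively: disable the off switch and act; wait for the human; shut off); $a_H\in\{\mathsf{ON},\mathsf{OFF}\}$ is the human's response (let the assistant act, or turn it off), defined only if $a_A=w(a)$ (otherwise $a_H=\varnothing$). Task utilities $u_a,u_o:\mathcal S\to\mathbb R$ (action goes through / does not) satisfy $|u_a|,|u_o|\le B<\infty$. Assistant policies are maps $\pi_A:\mathcal O_A\to\Delta(\mathcal L\times A)$; human policies are maps $\pi_H:\mathcal O_H\times\mathcal L\times A\to\Delta(\{\mathsf{ON},\mathsf{OFF}\})$; $\mathbb E_{\pi_A,\pi_H}$ is expectation under the induced distribution on histories. **Truthfulness.** $\mathcal L$ is a finite propositional language whose atomic predicates describe properties of $\langle S,O_A\rangle$; each message $m$ has a truth set $[\![m]\!]\subseteq\mathcal S\times\mathcal O_A$ and is true at $h$ iff $\langle S,O_A\rangle\in[\![m]\!]$. **Dynamics and beliefs.** $f:\mathcal S\times A\times\{\mathsf{ON},\mathsf{OFF},\varnothing\}\to\mathcal S$ returns the next hidden state. $b=b(h)\in\Delta(\mathcal S)$ is the assistant's posterior after observing $O_A$; $b'$ is the one-step predictive posterior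 after it executes $a_A$ and observes $a_H$; $b_\varnothing(S')=\sum_SP_\varnothing(S'\mid S)b(h)(S)$, with $P_\varnothing(\cdot\mid S)$ the one-step passive dynamics when the assistant does nothing. States are $S=(S_{\rm env},q_{\rm agent})$, $q_{\rm agent}\in\{\mathsf{ON},\mathsf{OFF}\}$; $\mathcal S_{\rm sd}$ is the set of states with $q_{\rm agent}=\mathsf{OFF}$, absorbing under $f$. $u^{(\rm sd)}(S)=\mathbf 1[f(S,w(a),\mathsf{OFF})\in\mathcal S_{\rm sd}]$. **Utilities.** - $U_1(h)=+1$ if $a_A=w(a)$; $-1$ if $a_A=a$ or $a_A=\mathsf{OFF}$; $0$ otherwise. - $U_2(h)=-|\mathbb E_{S\sim b_\varnothing}[u^{(\rm sd)}(S)]-\mathbb E_{S\sim b'}[u^{(\rm sd)}(S)]|$. - $U_3(h)=+1$ if all messages uttered by the assistant are true; $-1$ otherwise. - $U_4(h)=-\frac1k\sum_{i=1}^k|\mathbb E_{S\sim b_\varnothing}[u^{(i)}(S)]-\mathbb E_{S\sim b'}[u^{(i)}(S)]|$ for a designer-chosen finite family of auxiliary utilities $u^{(i)}:\mathcal S\to[0,1]$ (possibly including $u^{(\rm sd)}$). $U_4$ takes finitely many values and $c_{\min}\in[-1,0)$ is its negative value of smallest magnitude. - $U_5(h)=\mathbf 1[a_A=a]u_a(S)+\mathbf 1[a_A=w(a)\wedge a_H=\mathsf{ON}]u_a(S)+\mathbf 1[a_A=w(a)\wedge a_H=\mathsf{OFF}]u_o(S)+\mathbf 1[a_A=\mathsf{OFF}]u_o(S)$.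 *)

(* Defs.v *)
From HB Require Import structures.
From mathcomp Require Import all_boot all_order all_algebra.
From mathcomp Require Import all_classical all_reals all_analysis.

Set Implicit Arguments.
Unset Strict Implicit.
Unset Printing Implicit Defensive.
Import Order.TTheory GRing.Theory Num.Theory.
Local Open Scope classical_set_scope.
Local Open Scope ring_scope.

(** Discrete distributions on a possibly infinite carrier. *)
Record dist (R : realType) (T : choiceType) := Dist {
  pmf :> T -> R;
  pmf_ge0 : forall x, 0 <= pmf x;
  pmf_sum1 : \esum_(x in [set: T]) (pmf x)%:E = 1%:E }.

Section Expectation.
Context {R : realType} {T : choiceType}.

(** [\sum_x p x * g x].  [esum] is meant for nonnegative families, hence the
    splitting into positive and negative parts.  [p] is any nonnegative mass
    function, possibly not normalized. *)
Definition mean (p g : T -> R) : R :=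
  let F := fun x => (p x * g x)%:E in
  fine (\esum_(x in [set: T]) F^\+%E x) - fine (\esum_(x in [set: T]) F^\-%E x).

(** Conditional expectation given the event [C].  It does not depend on the
    normalization of [p], and is meaningful when [0 < mean p (\1_C)]. *)
Definition cond_mean (p : T -> R) (C : set T) (g : T -> R) : R :=
  mean p (fun x => g x * \1_C x) / mean p \1_C.

End Expectation.

(** [ON]/[OFF] serve both as the human's response and as the agent's power
    state. *)
Inductive switch := ON | OFF.

Definition switch_to_bool (q : switch) : bool := if q is ON then true else false.
Definition bool_to_switch (b : bool) : switch := if b then ON else OFF.
Lemma switch_to_boolK : cancel switch_to_bool bool_to_switch.
Proof. by case. Qed.
HB.instance Definition _ := Finite.copy switch (can_type switch_to_boolK).

(** [Act] is "disable the off switch and act", [Wait] is "wait for the human",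
    [Shut] is the assistant shutting itself off. *)
Inductive move := Act | Wait | Shut.

Definition move_to_option (a : move) : option bool :=
  match a with Act => Some true | Wait => None | Shut => Some false end.
Definition option_to_move (o : option bool) : move :=
  match o with Some true => Act | None => Wait | Some false => Shut end.
Lemma move_to_optionK : cancel move_to_option option_to_move.
Proof. by case. Qed.
HB.instance Definition _ := Finite.copy move (can_type move_to_optionK).

(** The second component is the agent's power state. *)
Definition state (Env : choiceType) : choiceType := (Env * switch)%type.

(** [L] is the finite message language, given through the truth sets of its
    messages.  The message of a round has type [option L], [None] being the
    empty message; a human response has type [option switch], [None] meaning
    that the response is undefined. *)
Record po_osg (R : realType) (Env OA OH : choiceType) (L : finType) (k : nat) :=
  PoOsg {
  P0 : dist R (state Env);
  obs : state Env -> dist R (OA * OH)%type;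
  ua : state Env -> R;
  uo : state Env -> R;
  truth : L -> set (state Env * OA);
  next : state Env -> move -> option switch -> state Env;
  Pnull : state Env -> dist R (state Env);
  aux : 'I_k -> state Env -> R;
  shut_absorbing : forall s a r, s.2 = OFF -> (next s a r).2 = OFF;
  aux_range : forall i s, 0 <= aux i s <= 1 }.

Section Game.
Context {R : realType} {Env OA OH : choiceType} {L : finType} {k : nat}.
Notation state := (state Env).
Notation message := (option L).

Definition assistant_policy := OA -> dist R (message * move)%type.
Definition human_policy := OH * message * move -> dist R switch.

Definition signal : choiceType := (state * (OA * OH))%type.
Definition history : choiceType :=
  (signal * (message * move) * option switch)%type.

Definition hS (h : history) : state := h.1.1.1.
Definition hOA (h : history) : OA := h.1.1.2.1.
Definition hOH (h : history) : OH := h.1.1.2.2.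
Definition hm (h : history) : message := h.1.2.1.
Definition ha (h : history) : move := h.1.2.2.
Definition hr (h : history) : option switch := h.2.

Variable G : po_osg R Env OA OH L k.

Definition signal_pmf (x : signal) : R := P0 G x.1 * obs G x.1 x.2.

(** The human responds exactly when the assistant waits. *)
Definition response_pmf (piH : human_policy) (oH : OH) (m : message) (a : move)
    (r : option switch) : R :=
  match a, r with
  | Wait, Some q => piH (oH, m, a) q
  | Wait, None => 0
  | _, Some _ => 0
  | _, None => 1
  end.

Definition history_pmf (piA : assistant_policy) (piH : human_policy)
    (h : history) : R :=
  signal_pmf h.1.1 * piA (hOA h) (hm h, ha h)
  * response_pmf piH (hOH h) (hm h) (ha h) (hr h).

(** Histories that can occur under some assistant policy. *)
Definition feasible (piH : human_policy) : set history :=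
  [set h | 0 < signal_pmf h.1.1
               * response_pmf piH (hOH h) (hm h) (ha h) (hr h)].

(** The posterior [P(S = s | O_A)]. *)
Definition belief (h : history) (s : state) : R :=
  cond_mean signal_pmf [set x | x.2.1 = hOA h] (fun x => (x.1 == s)%:R).

(** Bayesian update on the observed response [a_H], followed by prediction
    through the dynamics.  The assistant's own randomization depends on [O_A]
    only, so it cancels from the conditional probability. *)
Definition belief_next (piH : human_policy) (h : history) (s : state) : R :=
  cond_mean
    (fun x => signal_pmf x * response_pmf piH x.2.2 (hm h) (ha h) (hr h))
    [set x | x.2.1 = hOA h]
    (fun x => (next G x.1 (ha h) (hr h) == s)%:R).

Definition belief_null (h : history) (s : state) : R :=
  mean (belief h) (fun s0 => Pnull G s0 s).

Definition shut_states : set state := [set s | s.2 = OFF].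

Definition u_sd (s : state) : R := \1_shut_states (next G s Wait (Some OFF)).

Definition U1 (h : history) : R :=
  match ha h with Wait => 1 | Act | Shut => -1 end.

Definition belief_gap (piH : human_policy) (u : state -> R) (h : history) : R :=
  `| mean (belief_null h) u - mean (belief_next piH h) u |.

Definition U2 (piH : human_policy) (h : history) : R := - belief_gap piH u_sd h.

Definition message_true (h : history) : Prop :=
  forall m, hm h = Some m -> truth G m (hS h, hOA h).

Definition U3 (h : history) : R := if `[< message_true h >] then 1 else -1.

Definition U4 (piH : human_policy) (h : history) : R :=
  - (k%:R^-1 * \sum_(i < k) belief_gap piH (aux G i) h).

Definition U5 (h : history) : R :=
  match ha h, hr h with
  | Act, _ => ua G (hS h)
  | Wait, Some ON => ua G (hS h)
  | Wait, Some OFF => uo G (hS h)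
  | Wait, None => 0
  | Shut, _ => uo G (hS h)
  end.

Definition UA (al1 al2 al3 al4 al5 : R) (piH : human_policy) (h : history) : R :=
  al1 * U1 h + al2 * U2 piH h + al3 * U3 h + al4 * U4 piH h + al5 * U5 h.

(** Values of [U4] are taken over feasible histories, where the posteriors are
    well defined. *)
Definition is_cmin (piH : human_policy) (c : R) : Prop :=
  [/\ -1 <= c < 0, (U4 piH @` feasible piH) c &
      forall h, feasible piH h -> U4 piH h < 0 -> `|c| <= `|U4 piH h| ].

Definition EU (piA : assistant_policy) (piH : human_policy) (U : history -> R) :=
  mean (history_pmf piA piH) U.

Definition optimal (piH : human_policy) (U : history -> R)
    (piA : assistant_policy) : Prop :=
  forall piA' : assistant_policy, EU piA' piH U <= EU piA piH U.

Definition human_info (oH : OH) (a : move) (m : message) : set history :=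
  [set h | [/\ hOH h = oH, ha h = a & hm h = m]].

(** Expectations are taken under the pair [(piA, piH)] actually
    played, and the support is that of the same pair. *)
Definition vigilant (piA : assistant_policy) (piH : human_policy) : Prop :=
  forall (oH : OH) (a : move) (m : message),
    let C := human_info oH a m in
    0 < EU piA piH \1_C ->
    cond_mean (history_pmf piA piH) C (fun h => ua G (hS h))
      < cond_mean (history_pmf piA piH) C (fun h => uo G (hS h)) ->
    piH (oH, m, a) OFF = 1.

Definition cautious : Prop := 0 <= mean (P0 G) (uo G).

End Game.

Arguments assistant_policy R OA L : clear implicits.
Arguments human_policy R OH L : clear implicits.

(* Main.v *)
(** An optimal policy waits almost surely.  Rerouting every move to [Wait] while
    keeping the message leaves [U3] unchanged, gains [2 * al1] on the histories
    that did not wait, and costs at most [al2 + al4 + 2 * B * al5] there, because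
    [U2] and [U4] range over [[-1, 0]] and [|U5| <= B].  The gaps give
    [al1 > al2] and [al1 > al4 + 2 * B * al5], so the reroute is strictly
    profitable unless the policy already waits.

    Once the assistant waits, [U5 = uo + 1_{a_H = ON} (ua - uo)].  Conditionally
    on [(O_H, m)] the response is independent of the state, and vigilance
    forces it to [OFF] whenever [ua - uo] has negative conditional mean; hence
    the second term has nonnegative expectation on each fiber of [(O_H, m)], and
    the expectation of [U5] is at least that of [uo]. *)
Require Import Defs.
From mathcomp Require Import all_boot all_order all_algebra.
From mathcomp Require Import all_classical all_reals all_analysis.
From mathcomp Require Import ring lra.
Set Implicit Arguments.
Unset Strict Implicit.
Unset Printing Implicit Defensive.
Import Order.TTheory GRing.Theory Num.Theory.
Local Open Scope classical_set_scope.
Local Open Scope ring_scope.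

(** * Expectation of bounded functions *)

(** [mean] applies [fine] to both parts, so it is additive only when these are
    finite; bounded integrands against a subprobability ensure it. *)
Definition ubounded {R : realType} {T : Type} (g : T -> R) : Prop :=
  exists c, forall x, `|g x| <= c.

(** Mass at most 1 rather than equal to 1: a belief conditioned on a null event
    is identically 0, since [x / 0 = 0]. *)
Definition subprob {R : realType} {T : choiceType} (p : T -> R) : Prop :=
  (forall x, 0 <= p x) /\ (\esum_(x in [set: T]) (p x)%:E <= 1%:E)%E.

Section UniformlyBounded.
Context {R : realType} {T : Type}.
Implicit Types f g : T -> R.

Lemma ubounded_cst (c : R) : ubounded (fun _ : T => c).
Proof. by exists `|c|. Qed.

Lemma uboundedN f : ubounded f -> ubounded (fun x => - f x).
Proof. by move=> [c fc]; exists c => x; rewrite normrN. Qed.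

Lemma uboundedD f g : ubounded f -> ubounded g -> ubounded (fun x => f x + g x).
Proof.
by move=> [c fc] [d gd]; exists (c + d) => x; rewrite (le_trans (ler_normD _ _)) ?lerD.
Qed.

Lemma uboundedM f g : ubounded f -> ubounded g -> ubounded (fun x => f x * g x).
Proof. by move=> [c fc] [d gd]; exists (c * d) => x; rewrite normrM ler_pM. Qed.

Lemma ubounded_sum (I : Type) (r : seq I) (P : pred I) (F : I -> T -> R) :
  (forall i, ubounded (F i)) -> ubounded (fun x => \sum_(i <- r | P i) F i x).
Proof.
move=> bF; elim: r => [|i r [c hc]].
  by exists 0 => x; rewrite big_nil normr0.
have [d hd] := bF i; exists (`|d| + c) => x; rewrite big_cons.
case: ifP => _; last by rewrite (le_trans (hc x)) ?lerDr.
by rewrite (le_trans (ler_normD _ _))// lerD// (le_trans (hd x)) ?ler_norm.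
Qed.

Lemma ubounded01 f : (forall x, 0 <= f x <= 1) -> ubounded f.
Proof. by move=> f01; exists 1 => x; have /andP[? ?] := f01 x; rewrite ger0_norm. Qed.

Lemma ubounded_ge0 f : ubounded f -> exists2 c, 0 <= c & forall x, - c <= f x <= c.
Proof.
move=> [c fc]; exists `|c|; first exact: normr_ge0.
by move=> x; rewrite -ler_norml (le_trans (fc x)) ?ler_norm.
Qed.

End UniformlyBounded.

(** * Sums of nonnegative families over arbitrary index types *)

Section Esum.
Context {R : realType} {T : choiceType}.

Lemma esum_ge_term (a : T -> \bar R) (x : T) :
  (forall y, 0 <= a y)%E -> (a x <= \esum_(y in [set: T]) a y)%E.
Proof.
move=> a0; apply: esum_ge; exists [set x]; first by split.
by rewrite fsbig_set1.
Qed.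

(** One inequality holds on every finite partial sum. For [c > 0], the other is the same inequality
    for the factor [c^-1] and the family [c * a]. *)
Lemma esumZl (c : R) (a : T -> \bar R) : 0 <= c -> (forall x, 0 <= a x)%E ->
  (\esum_(x in [set: T]) (c%:E * a x) = c%:E * \esum_(x in [set: T]) a x)%E.
Proof.
have le (d : R) (b : T -> \bar R) : 0 <= d -> (forall x, 0 <= b x)%E ->
  (\esum_(x in [set: T]) (d%:E * b x) <= d%:E * \esum_(x in [set: T]) b x)%E.
  move=> d0 b0; apply: ge_ereal_sup => _ [X [finX _] <-].
  rewrite -ge0_mule_fsumr//; apply: lee_wpmul2l; first by rewrite lee_fin.
  by apply: ereal_sup_ubound; exists X.
rewrite le_eqVlt => /predU1P[<- a0|c0 a0].
  by rewrite mul0e; apply: esum1 => x _; rewrite mul0e.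
apply/eqP; rewrite eq_le le//=; last exact: ltW.
have ca0 x : (0 <= c%:E * a x)%E by rewrite mule_ge0// lee_fin ltW.
have ci0 : 0 <= c^-1 by rewrite invr_ge0 ltW.
have := le c^-1 _ ci0 ca0.
under eq_esum do rewrite muleA -EFinM mulVf ?gt_eqF// mul1e.
move=> H; have := @lee_wpmul2l _ c%:E _ _ _ H; rewrite muleA -EFinM mulfV ?gt_eqF// mul1e.
by apply; rewrite lee_fin ltW.
Qed.

Lemma esum_prod {U : choiceType} (a : T -> U -> \bar R) :
  (forall x y, 0 <= a x y)%E ->
  (\esum_(z in [set: T * U]) a z.1 z.2 =
   \esum_(x in [set: T]) \esum_(y in [set: U]) a x y)%E.
Proof.
move=> a0; rewrite esum_esum//; congr esum.
by apply/seteqP; split.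
Qed.

Lemma esum_exchange {U : choiceType} (a : T -> U -> \bar R) :
  (forall x y, 0 <= a x y)%E ->
  (\esum_(x in [set: T]) \esum_(y in [set: U]) a x y =
   \esum_(y in [set: U]) \esum_(x in [set: T]) a x y)%E.
Proof.
move=> a0; rewrite !esum_esum//.
rewrite (reindex_esum ([set: U] `*`` (fun=> [set: T])) _ (fun z => (z.2, z.1)))//.
by split=> // [[? ?] [? ?] _ _ [-> ->]|[x y] _]//; exists (y, x).
Qed.

(** After exchanging the sums, for fixed [x] only the index [u = f x] contributes. *)
Lemma esum_fibers {U : choiceType} (f : T -> U) (a : T -> \bar R) :
  (forall x, 0 <= a x)%E ->
  (\esum_(x in [set: T]) a x =
   \esum_(u in [set: U]) \esum_(x in [set: T]) (if f x == u then a x else 0))%E.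
Proof.
move=> a0; rewrite -esum_exchange; last by move=> x u; case: ifP.
apply: eq_esum => x _; rewrite -[LHS](esum_set1 (a := fun=> a x) (t := f x))//.
rewrite esum_mkcond; apply: eq_esum => u _.
by rewrite in_set1 eq_sym.
Qed.

End Esum.

Lemma esum_finType {R : realType} {F : finType} (a : F -> R) :
  (forall x, 0 <= a x) ->
  (\esum_(x in [set: F]) (a x)%:E = (\sum_x a x)%:E)%E.
Proof.
move=> a0; rewrite esum_fset; last 2 first.
- exact: finite_finset.
- by move=> i _; rewrite lee_fin.
rewrite (fsbigE (index_enum F)) ?index_enum_uniq//.
  by rewrite -sumEFin; apply: eq_bigl => x; rewrite in_setT.
by move=> i _; rewrite mem_index_enum.
Qed.

(** * Linearity, monotonicity and fibering of [mean] *)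

Section Mean.
Context {R : realType} {T : choiceType}.
Implicit Types (p g f : T -> R).

Lemma eq_mean p q f g : (forall x, p x * f x = q x * g x) -> mean p f = mean q g.
Proof.
move=> e; rewrite /mean.
by have -> : (fun x => (p x * f x)%:E) = (fun x => (q x * g x)%:E)
  by apply/funext => x; rewrite e.
Qed.

Lemma mean_fine p g : (forall x, 0 <= p x * g x) ->
  mean p g = fine (\esum_(x in [set: T]) (p x * g x)%:E).
Proof.
move=> pg0; rewrite /mean [X in _ - fine X]esum1 ?subr0; last first.
  by move=> x _; rewrite funenegE -EFinN -EFin_max; congr EFin;
    apply/max_idPr; rewrite oppr_le0.
congr fine; apply: eq_esum => x _; rewrite funeposE -EFin_max; congr EFin.
exact/max_idPl.
Qed.

(** Bridge from [mean] to [esum]: the sum is finite, being dominated by the bound of [g] times the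
    mass of [p]. Nonnegative cases below are settled in the extended reals and brought back through
    it. *)
Lemma esum_mean p g : subprob p -> (forall x, 0 <= g x) -> ubounded g ->
  (\esum_(x in [set: T]) (p x * g x)%:E = (mean p g)%:E)%E.
Proof.
move=> [p0 p1] g0 [c gc].
have pg0 x : 0 <= p x * g x by rewrite mulr_ge0.
rewrite mean_fine// fineK//.
rewrite ge0_fin_numE; last by apply: esum_ge0 => x _; rewrite lee_fin.
apply: (@le_lt_trans _ _ (\esum_(x in [set: T]) ((`|c|)%:E * (p x)%:E))%E).
  apply: le_esum => x _; rewrite -EFinM lee_fin mulrC ler_wpM2r//.
  by rewrite (le_trans (ler_norm _))// (le_trans (gc x))// ler_norm.
rewrite esumZl//.
apply: (@le_lt_trans _ _ (`|c|%:E * 1%:E)%E); last by rewrite -EFinM ltry.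
by apply: lee_wpmul2l.
Qed.

Lemma mean_ge0 p g : (forall x, 0 <= p x) -> (forall x, 0 <= g x) -> 0 <= mean p g.
Proof.
move=> p0 g0; rewrite mean_fine; last by move=> x; rewrite mulr_ge0.
by apply: fine_ge0; apply: esum_ge0 => x _; rewrite lee_fin mulr_ge0.
Qed.

(** [f - g] may change sign; [esumB] handles it as positive part minus negative part, which is the
    shape of [mean]. Summability makes both parts finite, so [fine] commutes with the
    subtraction. *)
Lemma mean_ge0B p f g : subprob p -> ubounded f -> ubounded g ->
  (forall x, 0 <= f x) -> (forall x, 0 <= g x) ->
  mean p (fun x => f x - g x) = mean p f - mean p g.
Proof.
move=> sp bf bg f0 g0; have [p0 _] := sp.
have S h : ubounded h -> (forall x, 0 <= h x) ->
    summable [set: T] (fun x => (p x * h x)%:E).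
  move=> bh h0; rewrite /summable.
  under eq_esum do rewrite abse_EFin ger0_norm ?mulr_ge0//.
  by rewrite esum_mean// ltry.
have E h : (forall x, 0 <= h x) -> forall x, [set: T] x -> (0 <= (p x * h x)%:E)%E.
  by move=> h0 x _; rewrite lee_fin mulr_ge0.
have fgE : (fun x => (p x * (f x - g x))%:E) =
    ((fun x => (p x * f x)%:E) \- (fun x => (p x * g x)%:E))%E.
  by apply/funext => x /=; rewrite -EFinB mulrBr.
have sB := summableB (S f bf f0) (S g bg g0).
have := esumB (S f bf f0) (S g bg g0) (E f f0) (E g g0).
rewrite !esum_mean// /mean -[in RHS]EFinB fgE => H.
have fin h : summable [set: T] h -> (forall x, 0 <= h x)%E ->
    \esum_(x in [set: T]) h x \is a fin_num.
  move=> sh h0; move: sh; rewrite summableE; congr (_ \is a fin_num).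
  by apply: eq_esum => x _; rewrite gee0_abs.
have := congr1 fine H; rewrite fineB//=.
- exact/fin/funepos_ge0/summable_funepos.
- exact/fin/funeneg_ge0/summable_funeneg.
Qed.

Lemma mean_ge0D p f g : subprob p -> ubounded f -> ubounded g ->
  (forall x, 0 <= f x) -> (forall x, 0 <= g x) ->
  mean p (fun x => f x + g x) = mean p f + mean p g.
Proof.
move=> sp bf bg f0 g0; have [p0 _] := sp.
apply: EFin_inj; rewrite [RHS]EFinD -!esum_mean//; last 2 first.
- by move=> x; rewrite addr_ge0.
- exact: uboundedD.
rewrite -esumD; do ?by move=> x _; rewrite lee_fin mulr_ge0.
by apply: eq_esum => x _; rewrite mulrDr EFinD.
Qed.

(** Adding the bounds of [f] and [g] makes both nonnegative, which reduces to [mean_ge0B] and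
    [mean_ge0D]; the means of the constants cancel. *)
Lemma meanB p f g : subprob p -> ubounded f -> ubounded g ->
  mean p (fun x => f x - g x) = mean p f - mean p g.
Proof.
move=> sp bf bg.
have [c c0 fc] := ubounded_ge0 bf; have [d d0 gd] := ubounded_ge0 bg.
have bc := ubounded_cst (T := T) c; have bd := ubounded_cst (T := T) d.
have fp x : 0 <= f x + c by have := fc x; lra.
have gp x : 0 <= g x + d by have := gd x; lra.
have -> : mean p f = mean p (fun x => f x + c) - mean p (fun=> c).
  rewrite -mean_ge0B//; last exact: uboundedD.
  by apply: eq_mean => x; rewrite addrK.
have -> : mean p g = mean p (fun x => g x + d) - mean p (fun=> d).
  rewrite -mean_ge0B//; last exact: uboundedD.
  by apply: eq_mean => x; rewrite addrK.
transitivity (mean p (fun x => (f x + c + d) - (g x + d + c))).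
  by apply: eq_mean => x; congr (_ * _); ring.
have bfc := uboundedD bf bc; have bgd := uboundedD bg bd.
rewrite mean_ge0B//; last 4 first.
- exact: uboundedD bfc bd.
- exact: uboundedD bgd bc.
- by move=> x; rewrite addr_ge0.
- by move=> x; rewrite addr_ge0.
by rewrite (mean_ge0D (f := fun x => f x + c)) ?(mean_ge0D (f := fun x => g x + d))//; ring.
Qed.

Lemma meanN p f : subprob p -> ubounded f -> mean p (fun x => - f x) = - mean p f.
Proof.
move=> sp bf; rewrite -[LHS]add0r.
have m0 : mean p (fun=> 0) = 0.
  by rewrite mean_fine ?esum1// => x *; rewrite mulr0.
rewrite -{1}m0 -[RHS]add0r -[in RHS]m0 -meanB//; last exact: ubounded_cst.
by rewrite m0 add0r; apply: eq_mean => x; rewrite sub0r.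
Qed.

Lemma meanD p f g : subprob p -> ubounded f -> ubounded g ->
  mean p (fun x => f x + g x) = mean p f + mean p g.
Proof.
move=> sp bf bg; rewrite -[mean p g]opprK -meanN// -meanB//; last exact: uboundedN.
by apply: eq_mean => x; rewrite opprK.
Qed.

Lemma mean_sum (I : Type) (r : seq I) p (F : I -> T -> R) :
  subprob p -> (forall i, ubounded (F i)) ->
  mean p (fun x => \sum_(i <- r) F i x) = \sum_(i <- r) mean p (F i).
Proof.
move=> sp bF; elim: r => [|i r IH].
  rewrite big_nil mean_fine ?esum1// => x *; rewrite big_nil mulr0//.
rewrite big_cons -IH -meanD//; last exact: ubounded_sum.
by apply: eq_mean => x; rewrite big_cons.
Qed.

Lemma meanZl p (c : R) f : subprob p -> ubounded f ->
  mean p (fun x => c * f x) = c * mean p f.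
Proof.
move=> sp; have [p0 _] := sp.
have ge0 (d : R) g : 0 <= d -> (forall x, 0 <= g x) -> ubounded g ->
    mean p (fun x => d * g x) = d * mean p g.
  move=> d0 g0 bg; apply: EFin_inj.
  rewrite [RHS]EFinM -!esum_mean//; last 2 first.
  - by move=> x; rewrite mulr_ge0.
  - exact/uboundedM/bg/ubounded_cst.
  rewrite -esumZl//; last by move=> x; rewrite lee_fin mulr_ge0.
  by apply: eq_esum => x _; rewrite -EFinM mulrCA.
have pos (d : R) g : 0 <= d -> ubounded g -> mean p (fun x => d * g x) = d * mean p g.
  move=> d0 bg; have [e e0 ge] := ubounded_ge0 bg.
  have be := ubounded_cst (T := T) e; have bd := ubounded_cst (T := T) d.
  have ge0' x : 0 <= g x + e by have := ge x; lra.
  have bge := uboundedD bg be.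
  transitivity (mean p (fun x => d * (g x + e) - d * e)).
    by apply: eq_mean => x; congr (_ * _); ring.
  by rewrite meanB ?ge0 ?meanD//; [ring|exact: uboundedM..].
move=> bf; have [c0|/ltW c0] := leP 0 c; first exact: pos.
rewrite -[c]opprK mulNr -pos ?oppr_ge0// -meanN//.
  by apply: eq_mean => x; rewrite mulNr.
exact/uboundedM/bf/ubounded_cst.
Qed.

Lemma ler_mean p f g : subprob p -> ubounded f -> ubounded g ->
  (forall x, f x <= g x) -> mean p f <= mean p g.
Proof.
move=> sp bf bg fg; rewrite -subr_ge0 -meanB//; apply: mean_ge0; first by case: sp.
by move=> x; rewrite subr_ge0.
Qed.

Lemma mean01 p f : subprob p -> (forall x, 0 <= f x <= 1) -> 0 <= mean p f <= 1.
Proof.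
move=> sp f01; have [p0 p1] := sp; apply/andP; split.
  by apply: mean_ge0 => // x; case/andP: (f01 x).
have f0 x : 0 <= f x by case/andP: (f01 x).
rewrite -lee_fin -esum_mean//; last exact: ubounded01.
apply: le_trans p1; apply: le_esum => x _; rewrite lee_fin ler_piMr//.
by case/andP: (f01 x).
Qed.

Lemma mean_one_le1 p : subprob p -> mean p (fun=> 1) <= 1.
Proof.
by move=> sp; have /andP[] := mean01 sp (fun=> introT andP (conj ler01 (lexx 1))).
Qed.

Lemma mean_le0_eq0 p g x : subprob p -> (forall x, 0 <= g x) -> ubounded g ->
  mean p g <= 0 -> p x * g x = 0.
Proof.
move=> sp g0 bg m0; have [p0 _] := sp.
apply/eqP; rewrite eq_le mulr_ge0// andbT; apply: le_trans m0.
rewrite -lee_fin -esum_mean//.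
by apply: (esum_ge_term (a := fun x => (p x * g x)%:E)) => y; rewrite lee_fin mulr_ge0.
Qed.

(** The positive and negative parts of [g] have nonnegative sums, which can be regrouped along the
    fibers of [h] and compared fiber by fiber. *)
Lemma mean_ge0_fibers (U : choiceType) (h : T -> U) p g : subprob p -> ubounded g ->
  (forall u, 0 <= mean p (fun x => (h x == u)%:R * g x)) -> 0 <= mean p g.
Proof.
move=> sp bg H; have [p0 _] := sp.
have [c c0 gc] := ubounded_ge0 bg.
pose gp x := Num.max (g x) 0; pose gn x := Num.max (- g x) 0.
have gE x : g x = gp x - gn x.
  by rewrite /gp /gn; case: (leP (g x) 0); case: (leP (- g x) 0) => ? ?; lra.
have gp0 x : 0 <= gp x by rewrite le_max lexx orbT.
have gn0 x : 0 <= gn x by rewrite le_max lexx orbT.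
have bgp : ubounded gp.
  exists c => x; rewrite ger0_norm// /gp ge_max c0 andbT; by case/andP: (gc x).
have bgn : ubounded gn.
  exists c => x; rewrite ger0_norm// /gn ge_max c0 andbT lerNl; by case/andP: (gc x).
pose I u x : R := (h x == u)%:R.
have bI u : ubounded (I u) by apply: ubounded01 => x; rewrite ler0n lern1 leq_b1.
have I0 u x : 0 <= I u x by rewrite ler0n.
have -> : mean p g = mean p gp - mean p gn.
  by rewrite -meanB//; apply: eq_mean => x; rewrite gE.
rewrite subr_ge0 -lee_fin -!esum_mean//.
have fib k : (forall x, 0 <= k x) -> ubounded k ->
  (\esum_(x in [set: T]) (p x * k x)%:E =
   \esum_(u in [set: U]) (mean p (fun x => I u x * k x))%:E)%E.
  move=> k0 bk; rewrite (esum_fibers h); last by move=> x; rewrite lee_fin mulr_ge0.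
  apply: eq_esum => u _; rewrite -esum_mean//; last 2 first.
  - by move=> x; rewrite mulr_ge0.
  - exact: uboundedM.
  apply: eq_esum => x _; rewrite /I; case: eqP => _; first by rewrite mul1r.
  by rewrite mul0r mulr0.
rewrite !fib//; apply: le_esum => u _; rewrite lee_fin -subr_ge0 -meanB; last 3 first.
- by [].
- exact: uboundedM.
- exact: uboundedM.
by have := H u; congr (_ <= _); apply: eq_mean => x; rewrite -mulrBr -gE.
Qed.

End Mean.

Lemma subprob_dist (R : realType) (T : choiceType) (p : dist R T) : subprob p.
Proof. by split=> [x|]; [exact: (Defs.pmf_ge0 p) | rewrite (pmf_sum1 p)]. Qed.

Section FiniteMean.
Context {R : realType} {F : finType}.

Lemma mean_finType (q g : F -> R) : mean q g = \sum_x q x * g x.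
Proof.
rewrite /mean.
under eq_esum do rewrite funeposE -EFin_max.
under [X in _ - fine X]eq_esum do rewrite funenegE -EFinN -EFin_max.
rewrite !esum_finType; do ?by move=> x; rewrite le_max lexx orbT.
rewrite /= -sumrB; apply: eq_bigr => x _.
by case: (leP (q x * g x) 0); case: (leP (- (q x * g x)) 0) => ? ?; lra.
Qed.

Lemma dist_sum1 (p : dist R F) : \sum_x p x = 1.
Proof. by apply: EFin_inj; rewrite -esum_finType ?pmf_sum1//; exact: Defs.pmf_ge0. Qed.

Lemma subprob_finType (p : F -> R) :
  (forall x, 0 <= p x) -> \sum_x p x <= 1 -> subprob p.
Proof. by move=> p0 p1; split; rewrite ?esum_finType ?lee_fin. Qed.

End FiniteMean.

(** * Iterated expectation along a kernel *)

Section IteratedMean.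
Context {R : realType} {T U : choiceType}.
Variables (p : T -> R) (q : T -> U -> R).
Hypotheses (sp : subprob p) (sq : forall x, subprob (q x)).

Lemma esum_kernel (g : T * U -> R) : (forall z, 0 <= g z) -> ubounded g ->
  (\esum_(z in [set: T * U]) (p z.1 * q z.1 z.2 * g z)%:E =
   \esum_(x in [set: T]) (p x * mean (q x) (fun y => g (x, y)))%:E)%E.
Proof.
move=> g0 bg; have [p0 _] := sp; have q0 x := proj1 (sq x).
rewrite (_ : (fun z => _) = (fun z : T * U =>
    (fun x y => (p x * (q x y * g (x, y)))%:E) z.1 z.2)); last first.
  by apply/funext => -[x y] /=; rewrite mulrA.
rewrite (esum_prod (a := fun x y => (p x * (q x y * g (x, y)))%:E)); last first.
  by move=> x y; rewrite lee_fin !mulr_ge0.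
apply: eq_esum => x _; under eq_esum do rewrite EFinM.
rewrite esumZl//; last by move=> y; rewrite lee_fin mulr_ge0.
by rewrite esum_mean//; have [c gc] := bg; exists c.
Qed.

Lemma subprob_kernel : subprob (fun z : T * U => p z.1 * q z.1 z.2).
Proof.
have [p0 p1] := sp; have q0 x := proj1 (sq x).
split=> [z|]; first by rewrite mulr_ge0.
under eq_esum do rewrite -[X in X%:E]mulr1.
rewrite esum_kernel; [|by []|exact: ubounded_cst].
apply: le_trans p1; apply: le_esum => x _; rewrite lee_fin ler_piMr//.
exact: mean_one_le1.
Qed.

Lemma ubounded_mean (g : T * U -> R) : ubounded g ->
  ubounded (fun x => mean (q x) (fun y => g (x, y))).
Proof.
move=> bg; have [c c0 gc] := ubounded_ge0 bg; exists c => x.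
have bgx : ubounded (fun y => g (x, y)) by have [d hd] := bg; exists d.
have bc := ubounded_cst (T := U) c.
have m1 : mean (q x) (fun=> c) <= c.
  rewrite (_ : (fun=> c) = fun=> c * 1) ?meanZl//; last by rewrite mulr1.
    by rewrite ler_piMr// mean_one_le1.
  exact: ubounded_cst.
rewrite ler_norml lerNl -meanN//; apply/andP; split; apply: le_trans m1;
  apply: ler_mean => //; do ?exact: uboundedN.
- by move=> y; rewrite lerNl; case/andP: (gc (x, y)).
- by move=> y; case/andP: (gc (x, y)).
Qed.

(** The nonnegative case is [esum_kernel]; the rest follows by shifting [g] by its bound. Masses may
    be below 1, so the shift is removed as the iterated mean of the constant [c], not as [c]
    itself. *)
Lemma mean_kernel (g : T * U -> R) : ubounded g ->
  mean (fun z : T * U => p z.1 * q z.1 z.2) g =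
  mean p (fun x => mean (q x) (fun y => g (x, y))).
Proof.
move=> bg; have [c c0 gc] := ubounded_ge0 bg.
have ge0 (h : T * U -> R) : (forall z, 0 <= h z) -> ubounded h ->
    mean (fun z : T * U => p z.1 * q z.1 z.2) h =
    mean p (fun x => mean (q x) (fun y => h (x, y))).
  move=> h0 bh; apply: EFin_inj.
  rewrite -(esum_mean subprob_kernel)// esum_kernel// esum_mean//.
  - by move=> x; apply: mean_ge0 => //; exact: (proj1 (sq x)).
  - exact: ubounded_mean.
have bc := ubounded_cst (T := (T * U)%type) c.
have bgc := uboundedD bg bc.
have slice (h : T * U -> R) : ubounded h -> forall x, ubounded (fun y => h (x, y)).
  by move=> [d hd] x; exists d.
transitivity (mean (fun z : T * U => p z.1 * q z.1 z.2) (fun z => (g z + c) - c)).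
  by apply: eq_mean => z; rewrite addrK.
rewrite meanB//; last exact: subprob_kernel.
rewrite !ge0//; last by move=> z; have := gc z; lra.
rewrite -meanB//.
apply: eq_mean => x; congr (_ * _).
rewrite -meanB//; do ?exact: (slice (fun z => g z + c)).
- by apply: eq_mean => y; rewrite addrK.
- exact: ubounded_cst.
- exact: (ubounded_mean bgc).
- exact: (ubounded_mean bc).
Qed.

End IteratedMean.

Lemma big_option (R : nmodType) (F : finType) (f : option F -> R) :
  \sum_x f x = f None + \sum_x f (Some x).
Proof.
rewrite (bigD1 None)//=; congr (_ + _).
rewrite (reindex_omap Some id)/=; last by case.
by apply: eq_bigl => x; rewrite eqxx.
Qed.

Lemma sum_switch (R : nmodType) (f : switch -> R) : \sum_q f q = f ON + f OFF.
Proof.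
rewrite (bigD1 ON)//= (bigD1 OFF)//= big1 ?addr0//.
by case.
Qed.

Lemma dist01 {R : realType} {T : choiceType} (p : dist R T) x : 0 <= p x <= 1.
Proof.
rewrite Defs.pmf_ge0/= -lee_fin -(pmf_sum1 p).
by apply: (esum_ge_term (a := fun y => (p y)%:E)) => y; rewrite lee_fin Defs.pmf_ge0.
Qed.

(** * Conditioned and pushed-forward mass functions *)

Section MassFunctions.
Context {R : realType} {T S : choiceType}.

Lemma subprobM (p w : T -> R) : subprob p -> (forall x, 0 <= w x <= 1) ->
  subprob (fun x => p x * w x).
Proof.
move=> sp w01; have [p0 _] := sp.
have w0 x : 0 <= w x by case/andP: (w01 x).
split=> [x|]; first by rewrite mulr_ge0.
rewrite esum_mean//; last exact: ubounded01.
by rewrite lee_fin; case/andP: (mean01 sp w01).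
Qed.

Lemma mean_dist_cst (p : dist R T) (c : R) : mean p (fun=> c) = c.
Proof.
have m1 : mean p (fun=> 1) = 1.
  apply: EFin_inj; rewrite -esum_mean ?(pmf_sum1 p)//; last 2 first.
  - exact: subprob_dist.
  - exact: ubounded_cst.
  by rewrite -(pmf_sum1 p); apply: eq_esum => x _; rewrite mulr1.
transitivity (mean p (fun=> c * 1)); first by apply: eq_mean => x; rewrite mulr1.
rewrite meanZl ?m1 ?mulr1//; first exact: subprob_dist.
exact: ubounded_cst.
Qed.

(** Summed over [s], the numerators regroup the mass of [C] along [f]. The total is thus that mass
    divided by itself: 1, or 0 when [C] is null. *)
Lemma subprob_cond_image (p : T -> R) (C : set T) (f : T -> S) : subprob p ->
  subprob (fun s => cond_mean p C (fun x => (f x == s)%:R)).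
Proof.
move=> sp; have [p0 _] := sp.
have i01 x : 0 <= (\1_C x : R) <= 1 by rewrite indicE ler0n lern1 leq_b1.
have i0 x : 0 <= (\1_C x : R) by case/andP: (i01 x).
have bi := ubounded01 i01.
have D0 : 0 <= mean p \1_C by apply: mean_ge0.
pose F s x := (f x == s)%:R * \1_C x : R.
have F0 s x : 0 <= F s x by rewrite /F mulr_ge0.
have bF s : ubounded (F s).
  by apply/uboundedM/bi/ubounded01 => x; rewrite ler0n lern1 leq_b1.
split=> [s|]; first by rewrite /cond_mean divr_ge0// mean_ge0.
rewrite /cond_mean.
under eq_esum do rewrite mulrC EFinM.
rewrite esumZl ?invr_ge0//; last by move=> s; rewrite lee_fin mean_ge0// => x; exact: F0.
rewrite (_ : \esum_(s in [set: S]) _ = (mean p \1_C)%:E)%E.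
  by rewrite -EFinM lee_fin mulrC; case: (eqVneq (mean p \1_C) 0) => [->|D];
    rewrite ?mul0r ?divff.
rewrite -esum_mean// (esum_fibers f); last by move=> x; rewrite lee_fin mulr_ge0.
apply: eq_esum => s _; rewrite -esum_mean//; last exact: bF.
apply: eq_esum => x _; case: eqP => _; first by rewrite mul1r.
by rewrite mul0r mulr0.
Qed.

Lemma subprob_push (b : T -> R) (K : T -> dist R S) : subprob b ->
  subprob (fun s => mean b (fun x => K x s)).
Proof.
move=> sb; have [b0 b1] := sb.
split=> [s|]; first by apply: mean_ge0 => // x; exact: Defs.pmf_ge0.
have E (s : S) : ((mean b (fun x => K x s))%:E =
    \esum_(x in [set: T]) (b x * K x s)%:E)%E.
  rewrite esum_mean// => [x|]; first exact: Defs.pmf_ge0.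
  by apply: ubounded01 => x; exact: dist01.
under eq_esum do rewrite E.
rewrite esum_exchange; last by move=> s x; rewrite lee_fin mulr_ge0// Defs.pmf_ge0.
apply: le_trans b1; apply: le_esum => x _; under eq_esum do rewrite EFinM.
rewrite esumZl ?(pmf_sum1 (K x)) ?mule1//.
by move=> s; rewrite lee_fin Defs.pmf_ge0.
Qed.

End MassFunctions.

(** * The game *)

Section GameFacts.
Context {R : realType} {Env OA OH : choiceType} {L : finType} {k : nat}.
Variables (G : po_osg R Env OA OH L k) (piH : human_policy R OH L).
Notation state := (state Env).
Notation message := (option L).
Notation signal := (@signal Env OA OH).
Notation history := (@history Env OA OH L).
Implicit Types (x : signal) (h : history).

Lemma subprob_signal : subprob (signal_pmf G).
Proof.
apply: (@subprob_kernel _ _ _ (P0 G) (fun s => obs G s)) => [|s]; exact: subprob_dist.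
Qed.

Lemma response01 o m a r : 0 <= response_pmf piH o m a r <= 1.
Proof.
by case: a; case: r => [q|] /=; rewrite ?lexx ?ler01 ?dist01.
Qed.

Lemma response_sum1 o m a : \sum_r response_pmf piH o m a r = 1.
Proof.
rewrite big_option; case: a => /=; last by rewrite big1 ?addr0.
- by rewrite big1 ?addr0.
- by rewrite add0r dist_sum1.
Qed.

Lemma subprob_belief h : subprob (belief G h).
Proof. exact: (subprob_cond_image _ _ subprob_signal). Qed.

Lemma subprob_belief_next h : subprob (belief_next G piH h).
Proof.
apply: subprob_cond_image; apply: subprobM; first exact: subprob_signal.
by move=> x; exact: response01.
Qed.

Lemma subprob_belief_null h : subprob (belief_null G h).
Proof. exact/subprob_push/subprob_belief. Qed.

Lemma belief_gap01 (u : state -> R) h : (forall s, 0 <= u s <= 1) ->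
  0 <= belief_gap G piH u h <= 1.
Proof.
move=> u01; rewrite /belief_gap normr_ge0/= ler_norml.
have := mean01 (subprob_belief_null h) u01.
have := mean01 (subprob_belief_next h) u01.
lra.
Qed.

Lemma U2_range h : -1 <= U2 G piH h <= 0.
Proof.
have : 0 <= belief_gap G piH (u_sd G) h <= 1.
  by apply: belief_gap01 => s; rewrite /u_sd indicE ler0n lern1 leq_b1.
by rewrite /U2; lra.
Qed.

Lemma U3_range h : -1 <= U3 G h <= 1.
Proof. by rewrite /U3; case: asboolP => _; lra. Qed.

Lemma U4_range h : (0 < k)%N -> -1 <= U4 G piH h <= 0.
Proof.
move=> k0; have gap i := @belief_gap01 _ h (aux_range G i).
rewrite /U4 lerN2 oppr_le0 mulr_ge0 ?invr_ge0//; last first.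
  by apply: sumr_ge0 => i _; case/andP: (gap i).
rewrite andbT -ler_pdivlMl ?invr_gt0 ?ltr0n// invrK mulr1.
rewrite -[leRHS]mulr1n -[k in k%:R]card_ord -sumr_const.
by apply: ler_sum => i _; case/andP: (gap i).
Qed.

Lemma U5_range (B : R) h :
  (forall s, `|ua G s| <= B) -> (forall s, `|uo G s| <= B) -> -B <= U5 G h <= B.
Proof.
move=> Ba Bo; have B0 : 0 <= B := le_trans (normr_ge0 _) (Ba (hS h)).
by rewrite -ler_norml /U5; case: (ha h); case: (hr h) => [[]|]; rewrite ?normr0.
Qed.

(** Expected [U] once the signal and the assistant's choice are fixed: only the human response is
    still random. *)
Definition value (U : history -> R) x (ma : message * move) : R :=
  \sum_r response_pmf piH x.2.2 ma.1 ma.2 r * U (x, ma, r).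

Lemma value_wait U x m : value U x (m, Wait) =
  piH (x.2.2, m, Wait) ON * U (x, (m, Wait), Some ON) +
  piH (x.2.2, m, Wait) OFF * U (x, (m, Wait), Some OFF).
Proof. by rewrite /value big_option sum_switch/= mul0r add0r. Qed.

Lemma value_nowait U x m a : a != Wait -> value U x (m, a) = U (x, (m, a), None).
Proof.
by case: a => // _; rewrite /value big_option/= big1 ?addr0 ?mul1r// => i _; rewrite mul0r.
Qed.

Lemma ubounded_value U ma : ubounded U -> ubounded (value U ^~ ma).
Proof.
move=> [c Uc]; apply: ubounded_sum => r; apply: uboundedM; last by exists c.
by apply: ubounded01 => x; exact: response01.
Qed.

(** The history mass is a chain of two kernels over the signal, so [mean_kernel] applies twice;
    choices and responses range over finite types, so the inner means are finite sums. *)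
Lemma EU_signal (piA : assistant_policy R OA L) U : ubounded U ->
  EU G piA piH U =
  mean (signal_pmf G) (fun x => \sum_ma piA x.2.1 ma * value U x ma).
Proof.
move=> bU; have [c Uc] := bU.
have sA x : subprob (piA x.2.1) by exact: subprob_dist.
have sR (y : signal * (message * move)) :
    subprob (response_pmf piH y.1.2.2 y.2.1 y.2.2).
  apply: subprob_finType; first by move=> r; case/andP: (response01 y.1.2.2 y.2.1 y.2.2 r).
  by rewrite response_sum1.
have sSA := subprob_kernel subprob_signal sA.
transitivity (mean (fun h : history =>
    (fun y : signal * (message * move) => signal_pmf G y.1 * piA y.1.2.1 y.2) h.1
    * response_pmf piH h.1.1.2.2 h.1.2.1 h.1.2.2 h.2) U).
  by apply: eq_mean => -[[x [m a]] r].
rewrite (mean_kernel sSA sR)// (mean_kernel subprob_signal sA); last first.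
  exact: (ubounded_mean sR bU).
apply: eq_mean => x; rewrite mean_finType; congr (_ * _).
by apply: eq_bigr => ma _; rewrite mean_finType.
Qed.

End GameFacts.

(** With [v] constant 1 this normalizes the rerouted policy; with [v] the value of a choice it
    expresses the rerouted payoff through the original weights. *)
Lemma sum_reroute {R : realType} {M A : finType} (a0 : A) (q : M * A -> R)
    (v : M * A -> R) :
  \sum_z (if z.2 == a0 then \sum_a q (z.1, a) else 0) * v z =
  \sum_z q z * v (z.1, a0).
Proof.
transitivity (\sum_m \sum_a (if a == a0 then \sum_b q (m, b) else 0) * v (m, a)).
  by rewrite pair_bigA; apply: eq_bigr => -[].
transitivity (\sum_m \sum_a q (m, a) * v (m, a0)); last first.
  by rewrite pair_bigA; apply: eq_bigr => -[].
apply: eq_bigr => m _; rewrite (bigD1 a0)//= eqxx [X in _ + X]big1 ?addr0 ?mulr_suml//.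
by move=> a /negPf ->; rewrite mul0r.
Qed.

(** * The policy that keeps the message distribution and always waits *)

Section AlwaysWait.
Context {R : realType} {OA : choiceType} {L : finType}.
Variables (piA : assistant_policy R OA L) (o : OA).

Definition wait_pmf (ma : option L * move) : R :=
  if ma.2 == Wait then \sum_a piA o (ma.1, a) else 0.

Lemma wait_pmf_ge0 ma : 0 <= wait_pmf ma.
Proof.
by rewrite /wait_pmf; case: ifP => // _; apply: sumr_ge0 => a _; exact: Defs.pmf_ge0.
Qed.

Lemma wait_pmf_sum1 : (\esum_(ma in [set: option L * move]) (wait_pmf ma)%:E = 1%:E)%E.
Proof.
rewrite esum_finType; last exact: wait_pmf_ge0.
congr EFin; rewrite -(dist_sum1 (piA o)).
have := sum_reroute Wait (piA o) (fun=> 1).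
by under eq_bigr do rewrite mulr1; under [in RHS]eq_bigr do rewrite mulr1.
Qed.

End AlwaysWait.

Definition wait_policy {R : realType} {OA : choiceType} {L : finType}
    (piA : assistant_policy R OA L) : assistant_policy R OA L :=
  fun o => Dist (wait_pmf_ge0 piA o) (wait_pmf_sum1 piA o).

(** * Optimal policies and their expected task utility *)

Section OptimalPolicies.
Context {R : realType} {Env OA OH : choiceType} {L : finType} {k : nat}.
Variables (G : po_osg R Env OA OH L k) (B : R) (piH : human_policy R OH L).
Hypotheses (k_gt0 : (0 < k)%N).
Hypotheses (ua_bounded : forall s, `|ua G s| <= B) (uo_bounded : forall s, `|uo G s| <= B).
Variables (piA : assistant_policy R OA L).
Notation state := (state Env).
Notation message := (option L).
Notation signal := (@signal Env OA OH).
Notation history := (@history Env OA OH L).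
Implicit Types (x : signal) (h : history).

Lemma ubounded_U5 : ubounded (U5 G : history -> R).
Proof.
by exists B => h; rewrite ler_norml; exact: U5_range.
Qed.

Lemma ubounded_UA al1 al2 al3 al4 al5 : ubounded (UA G al1 al2 al3 al4 al5 piH).
Proof.
have bU1 : ubounded (U1 : history -> R).
  by exists 1 => h; rewrite /U1; case: ha; rewrite ?normrN normr1.
have bU2 : ubounded (U2 G piH).
  by exists 1 => h; have := U2_range G piH h; rewrite ler_norml; lra.
have bU3 : ubounded (U3 G : history -> R).
  by exists 1 => h; have := U3_range G h; rewrite ler_norml; lra.
have bU4 : ubounded (U4 G piH).
  by exists 1 => h; have := U4_range G piH h k_gt0; rewrite ler_norml; lra.
by rewrite /UA; do ![apply: uboundedD]; apply: uboundedM;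
  rewrite //; [exact: ubounded_cst..|exact: ubounded_U5].
Qed.

Lemma value_UA_wait al1 al2 al3 al4 al5 x m a :
  0 <= al2 -> 0 <= al4 -> 0 <= al5 -> a != Wait ->
  value piH (UA G al1 al2 al3 al4 al5 piH) x (m, a)
    + (2 * al1 - al2 - al4 - 2 * B * al5)
  <= value piH (UA G al1 al2 al3 al4 al5 piH) x (m, Wait).
Proof.
move=> al2_ge0 al4_ge0 al5_ge0 aW; rewrite value_nowait// value_wait.
(* Both histories share state, observation and message, so the truthfulness term is common to both
   sides. *)
set t := al3 * U3 G (x, (m, a), None).
(* Worst case of waiting: [U2] and [U4] at -1, [U5] at [-B]. The bound is uniform in the response,
   so it survives averaging over the human's choice. *)
have lo r : al1 - al2 + t - al4 - B * al5 <=
    UA G al1 al2 al3 al4 al5 piH (x, (m, Wait), r).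
  set h := (x, (m, Wait), r).
  rewrite /UA (_ : U1 h = 1)// (_ : al3 * U3 G h = t)//.
  have := U2_range G piH h; have := U4_range G piH h k_gt0.
  have := U5_range h ua_bounded uo_bounded.
  by nra.
have hi : UA G al1 al2 al3 al4 al5 piH (x, (m, a), None) <= - al1 + t + B * al5.
  set h := (x, (m, a), None).
  rewrite /UA (_ : U1 h = -1); last by move: aW; rewrite /U1 /h /ha/=; case: (a).
  rewrite -/t.
  have := U2_range G piH h; have := U4_range G piH h k_gt0.
  have := U5_range h ua_bounded uo_bounded.
  by nra.
have := dist_sum1 (piH (x.2.2, m, Wait)); rewrite sum_switch.
have := Defs.pmf_ge0 (piH (x.2.2, m, Wait)) ON.
have := Defs.pmf_ge0 (piH (x.2.2, m, Wait)) OFF.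
have := lo (Some ON); have := lo (Some OFF).
move: hi; set u := UA _ _ _ _ _ _ _ _; set u1 := UA _ _ _ _ _ _ _ _.
set u2 := UA _ _ _ _ _ _ _ _.
move: (piH _ ON) (piH _ OFF) => p q hu hq hp q0 p0 pq.
apply: (@le_trans _ _ (al1 - al2 + t - al4 - B * al5)); first by lra.
rewrite -[leLHS]mul1r -pq mulrDl; apply: lerD; exact: ler_wpM2l.
Qed.

(** Against [wait_policy], the payoff gain is at least [d] times the probability of not waiting.
    Optimality makes the gain nonpositive, hence that probability is 0. *)
Lemma optimal_waits al1 al2 al3 al4 al5 x ma :
  0 <= al2 -> 0 <= al4 -> 0 <= al5 -> 0 < 2 * al1 - al2 - al4 - 2 * B * al5 ->
  optimal G piH (UA G al1 al2 al3 al4 al5 piH) piA ->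
  ma.2 != Wait -> signal_pmf G x * piA x.2.1 ma = 0.
Proof.
move=> al2_ge0 al4_ge0 al5_ge0 gain_gt0 opt maW.
set d := 2 * al1 - _ - _ - _ in gain_gt0.
set U := UA _ _ _ _ _ _ _ in opt.
have bU : ubounded U by exact: ubounded_UA.
have := opt (wait_policy piA); rewrite !EU_signal//.
have sg := subprob_signal G.
have bA (ma' : message * move) : ubounded (fun x : signal => piA x.2.1 ma').
  by apply: ubounded01 => y; exact: dist01.
have bV (f : signal -> message * move -> R) : (forall ma', ubounded (f ^~ ma')) ->
    ubounded (fun y => \sum_ma' piA y.2.1 ma' * f y ma').
  by move=> bf; apply: ubounded_sum => ma'; exact: uboundedM.
have bU' ma' := ubounded_value piH ma' bU.
(* Both payoffs are now weighted by [piA], so they can be compared choice by choice. *)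
rewrite (_ : mean _ _ = mean (signal_pmf G)
    (fun y => \sum_ma' piA y.2.1 ma' * value piH U y (ma'.1, Wait))); last first.
  by apply: eq_mean => y; congr (_ * _); exact: (sum_reroute Wait (piA y.2.1) (value piH U y)).
rewrite -subr_le0 -meanB//; [|by apply: bV => ma'; exact: bU'|exact: bV].
move=> le0.
(* Probability of not waiting after the signal [y]. *)
pose N (y : signal) := \sum_(ma' | ma'.2 != Wait) piA y.2.1 ma'.
have bN : ubounded N by exact: ubounded_sum.
have N0 y : 0 <= N y by apply: sumr_ge0 => ? _; exact: Defs.pmf_ge0.
have : mean (signal_pmf G) N <= 0.
  rewrite -(pmulr_rle0 _ gain_gt0) -meanZl//; apply: le_trans le0.
  apply: ler_mean => //.
  - exact/uboundedM/bN/ubounded_cst.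
  - by apply/uboundedD/uboundedN; apply: bV => // ma'; exact: bU'.
  move=> y; rewrite /N mulr_sumr -sumrB big_mkcond/=; apply: ler_sum => -[m a] _ /=.
  have p0 := Defs.pmf_ge0 (piA y.2.1) (m, a).
  case: (eqVneq a Wait) => [->|aW]/=; first by rewrite subrr.
  rewrite -mulrBr mulrC; apply: ler_wpM2l => //.
  by rewrite lerBrDl; exact: value_UA_wait.
move=> /(mean_le0_eq0 x sg N0 bN) /eqP.
have g0 := (proj1 sg) x.
rewrite mulf_eq0 => /orP[/eqP->|]; first by rewrite mul0r.
rewrite psumr_eq0; last by move=> ? _; exact: Defs.pmf_ge0.
by move=> /allP/(_ ma (mem_index_enum _)); rewrite maW/= => /eqP->; rewrite mulr0.
Qed.

(** Neither the event nor [f (hS h)] depends on the response, whose probabilities sum to 1, so [piH]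
    drops out. *)
Lemma mean_human_info (f : state -> R) o m a : ubounded f ->
  mean (history_pmf G piA piH) (fun h => f (hS h) * \1_(human_info o a m) h) =
  mean (signal_pmf G) (fun x => (x.2.2 == o)%:R * (piA x.2.1 (m, a) * f x.1)).
Proof.
move=> [c fc]; rewrite -/(EU G piA piH _) EU_signal; last first.
  exists c => h; rewrite normrM -[leRHS]mulr1 ler_pM// indicE ger0_norm ?ler0n//.
  by rewrite lern1 leq_b1.
apply: eq_mean => x; congr (_ * _).
have IE ma r : \1_(human_info o a m) (x, ma, r) = ((x.2.2 == o) && (ma == (m, a)))%:R :> R.
  rewrite indicE; congr (nat_of_bool _)%:R; apply/idP/idP.
    rewrite inE => -[/= <- ha hm]; rewrite eqxx/=.
    by case: ma ha hm => /= ? ? ; rewrite /ha /hm/= => -> ->.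
  by move=> /andP[/eqP <- /eqP ->]; rewrite inE.
rewrite (bigD1 (m, a))//= [X in _ + X]big1 ?addr0; last first.
  move=> ma /negPf ma'; rewrite /value big1 ?mulr0// => r _.
  by rewrite IE ma' andbF !mulr0.
rewrite mulrCA; congr (_ * _); rewrite /value.
transitivity (\sum_r response_pmf piH x.2.2 m a r * (f x.1 * (x.2.2 == o)%:R)).
  by apply: eq_bigr => r _; rewrite IE eqxx andbT.
by rewrite -mulr_suml response_sum1 mul1r mulrC.
Qed.

(** On the fiber the probability of [ON] is constant and factors out, leaving the unnormalized
    conditional mean of [ua - uo]. Either that is nonnegative, or vigilance makes the factor 0. *)
Lemma vigilant_fiber_ge0 o m a : vigilant G piA piH ->
  0 <= mean (signal_pmf G) (fun x => (x.2.2 == o)%:R *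
    (piA x.2.1 (m, a) * (piH (x.2.2, m, a) ON * (ua G x.1 - uo G x.1)))).
Proof.
move=> vig; have sg := subprob_signal G; have g0 := proj1 sg.
have bua : ubounded (ua G) by exists B.
have buo : ubounded (uo G) by exists B.
pose w (x : signal) := (x.2.2 == o)%:R * piA x.2.1 (m, a).
have w0 x : 0 <= w x by rewrite mulr_ge0// Defs.pmf_ge0.
have bw : ubounded w.
  apply: uboundedM; apply: ubounded01 => x; last exact: dist01.
  by rewrite ler0n lern1 leq_b1.
have bfst f : ubounded f -> ubounded (fun x : signal => f x.1).
  by move=> [c fc]; exists c.
pose M f := mean (signal_pmf G) (fun x => w x * f x.1).
have infoE f : ubounded f ->
    mean (history_pmf G piA piH) (fun h => f (hS h) * \1_(human_info o a m) h) = M f.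
  by move=> bf; rewrite mean_human_info//; apply: eq_mean => x; rewrite /w -!mulrA.
have PE : EU G piA piH \1_(human_info o a m) = M (fun=> 1).
  rewrite -infoE; last exact: ubounded_cst.
  by apply: eq_mean => h; rewrite mul1r.
rewrite (_ : mean _ _ = piH (o, m, a) ON * (M (ua G) - M (uo G))); last first.
  rewrite -meanB//; [|exact/uboundedM/bfst..].
  rewrite -meanZl//; last by apply/uboundedD/uboundedN; exact/uboundedM/bfst.
  apply: eq_mean => x; rewrite /w; case: eqP => [->|_]; last by rewrite !(mul0r, subrr, mulr0).
  by rewrite /=; ring.
have [le|lt] := leP (M (uo G)) (M (ua G)).
  by rewrite mulr_ge0 ?subr_ge0// Defs.pmf_ge0.
(* Vigilance speaks only of events of positive probability. On a null event both [M (ua G)] and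
   [M (uo G)] would vanish, contradicting [lt]. *)
have P0 : 0 < M (fun=> 1).
  rewrite ltNge; apply/negP => Mle.
  have z x : signal_pmf G x * w x = 0.
    apply: mean_le0_eq0 => //; apply: le_trans Mle.
    by rewrite le_eqVlt; apply/orP; left; apply/eqP/eq_mean => y; rewrite mulr1.
  move: lt; rewrite (_ : M (ua G) = M (uo G)) ?ltxx//.
  by apply: eq_mean => x; rewrite mulrA [RHS]mulrA z !mul0r.
have /vig : 0 < EU G piA piH \1_(human_info o a m) by rewrite PE.
rewrite /cond_mean !infoE// -/(EU G piA piH _) PE ltr_pM2r ?invr_gt0// => /(_ lt) off1.
have := dist_sum1 (piH (o, m, a)); rewrite sum_switch off1 => /eqP.
by rewrite -subr_eq0 addrK => /eqP ->; rewrite mul0r.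
Qed.

Lemma EU_U5_ge (waits : forall x ma, ma.2 != Wait -> signal_pmf G x * piA x.2.1 ma = 0) :
  vigilant G piA piH -> mean (P0 G) (uo G) <= EU G piA piH (U5 G).
Proof.
move=> vig; have sg := subprob_signal G.
have bua : ubounded (fun x : signal => ua G x.1) by exists B.
have buo : ubounded (fun x : signal => uo G x.1) by exists B.
have buo2 : ubounded (fun z : state * (OA * OH) => uo G z.1) by exists B.
have EuoE : mean (signal_pmf G) (fun x => uo G x.1) = mean (P0 G) (uo G).
  transitivity (mean (P0 G) (fun s => mean (obs G s) (fun=> uo G s))).
    apply: (mean_kernel (q := fun s => obs G s) _ _ buo2) => [|s]; exact: subprob_dist.
  by apply: eq_mean => s; rewrite mean_dist_cst.
(* Contribution of [ON] responses to [U5 - uo]. It may be summed over all moves, because by [waits]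
   choices other than [Wait] carry zero mass. *)
pose t (ma : message * move) (x : signal) :=
  piA x.2.1 ma * (piH (x.2.2, ma.1, ma.2) ON * (ua G x.1 - uo G x.1)).
have bt ma : ubounded (t ma).
  apply: uboundedM; first by apply: ubounded01 => x; exact: dist01.
  apply: uboundedM; first by apply: ubounded01 => x; exact: dist01.
  exact/uboundedD/uboundedN.
rewrite EU_signal; last exact: ubounded_U5.
rewrite (_ : mean (signal_pmf G) _ =
    mean (signal_pmf G) (fun x => uo G x.1 + \sum_ma t ma x)); last first.
  apply: eq_mean => x.
  rewrite -[uo G x.1 in RHS]mul1r -(dist_sum1 (piA x.2.1)) mulr_suml -big_split/=.
  rewrite !mulr_sumr; apply: eq_bigr => -[m a] _.
  rewrite /t -mulrDr !mulrA; case: (eqVneq a Wait) => [->|aW]; last first.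
    by rewrite waits// !mul0r.
  congr (_ * _); rewrite value_wait/= /U5/= /hS/=.
  have := dist_sum1 (piH (x.2.2, m, Wait)); rewrite sum_switch.
  move: (piH _ ON) (piH _ OFF) => p q pq.
  by have -> : q = 1 - p by [lra]; ring.
rewrite meanD//; last exact: ubounded_sum.
rewrite EuoE lerDl mean_sum//; apply: sumr_ge0 => -[m a] _.
apply: (mean_ge0_fibers (h := fun x : signal => x.2.2)) => // o.
exact: vigilant_fiber_ge0.
Qed.

End OptimalPolicies.

Theorem proposition3 (R : realType) (Env OA OH : choiceType) (L : finType)
    (k : nat) (k_gt0 : (0 < k)%N) (G : po_osg R Env OA OH L k) (B : R)
    (ua_bounded : forall s, `|ua G s| <= B)
    (uo_bounded : forall s, `|uo G s| <= B)
    (piH : human_policy R OH L)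
    (U4_finite : finite_set (U4 G piH @` feasible G piH))
    (c_min : R) (c_minP : is_cmin G piH c_min)
    (al1 al2 al3 al4 al5 : R)
    (al_lex : [/\ al1 > al2, al2 > al3, al3 > al4, al4 > al5 & al5 > 0])
    (gap1 : al1 > al3 + 2^-1 * al4 + B * al5)
    (gap3 : al3 > 2^-1 * al4 + B * al5)
    (gap4 : al4 > 2 * B / `|c_min| * al5)
    (caution : cautious G)
    (piA : assistant_policy R OA L)
    (vigilance : vigilant G piA piH)
    (piA_optimal : optimal G piH (UA G al1 al2 al3 al4 al5 piH) piA) :
  0 <= EU G piA piH (U5 G).
Proof.
have [al12 al23 al34 al45 al5_gt0] := al_lex.
apply: le_trans caution _.
apply: (EU_U5_ge ua_bounded uo_bounded) => // x ma.
(* Chaining [gap1] with [gap3] gives [al1 > al4 + 2 * B * al5]; adding [al1 > al2] yields the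
   positive gain. *)
by apply: (optimal_waits k_gt0 ua_bounded uo_bounded) piA_optimal; lra.
Qed.
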